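(* Let $\gamma>-1$. For every integer $m\ge0$, pullback by $Q$, $Q^*p=p\circ Q$, is a linear isomorphism $$Q^*:\Pi_m(V)\longrightarrow\Pi^{\mathrm{even}}_{2m}(\mathbb{B}^2),\qquad \Pi^{\mathrm{even}}_{2m}(\mathbb{B}^2)=\{P\in\Pi_{2m}(\mathbb{B}^2):P(-z)=P(z)\}.$$ Moreover, this map is unitary for the $L^2(V,\nu_\gamma)$ inner product on $\Pi_m(V)$ and the $L^2(\mathbb{B}^2,\mu_\gamma)$ inner product on $\Pi^{\mathrm{even}}_{2m}(\mathbb{B}^2)$.
   Context: $V=\{(x,y,t)\in\mathbb{R}^3:x^2+y^2=t^2,\ 0\le t\le1\}$, parametrized by $(x,y,t)=(t\cos\phi,t\sin\phi,t)$, with the probability measure $d\nu_\gamma(t,\phi)=\frac{\gamma+1}{2\pi}(1-t)^\gamma\,dt\,d\phi$ on $0\le t\le1$, $0\le\phi<2\pi$. $\mathbb{B}^2=\{(u,v)\in\mathbb{R}^2:u^2+v^2\le1\}$ carries the probability measure $d\mu_\gamma(u,v)=\frac{\gamma+1}{\pi}(1-u^2-v^2)^\gamma\,du\,dv$. The map $Q:\mathbb{B}^2\to V$ is $Q(u,v)=(u^2-v^2,\,2uv,\,u^2+v^2)$. $\Pi_m(V)$ (resp. $\Pi_m(\mathbb{B}^2)$) is the space of restrictions to $V$ (resp. $\mathbb{B}^2$) of polynomials in three (resp. two) real variables of total degree at most $m$. *)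

(* Defs.v *)
From HB Require Import structures.
From mathcomp Require Import all_boot all_order all_algebra.
From mathcomp Require Import -(notations) mpoly.
From mathcomp Require Import all_classical all_reals all_analysis.
From mathcomp Require Import measurable_realfun.
From mathcomp Require Import complex.

Set Implicit Arguments.
Unset Strict Implicit.
Unset Printing Implicit Defensive.
Import Order.TTheory GRing.Theory Num.Theory.
Import numFieldNormedType.Exports.

Local Open Scope classical_set_scope.
Local Open Scope ring_scope.

(* The notations of mpoly are not imported, because they clash with those of
   MathComp-Analysis. This is its msize: 1 + total degree, and 0 for the zero
   polynomial. *)
Notation mpsize p := (@mmeasure _ _ mdeg p).

Section Geometry.
Variable R : realType.

Definition cone : set (R * R * R) :=
  [set w | w.1.1 ^+ 2 + w.1.2 ^+ 2 = w.2 ^+ 2 /\ 0 <= w.2 <= 1].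

Definition cone_param (z : R * R) : R * R * R :=
  (z.1 * cos z.2, z.1 * sin z.2, z.1).

Definition disc : set (R * R) := [set z | z.1 ^+ 2 + z.2 ^+ 2 <= 1].

Definition Q (z : R * R) : R * R * R :=
  (z.1 ^+ 2 - z.2 ^+ 2, 2 * z.1 * z.2, z.1 ^+ 2 + z.2 ^+ 2).

Definition coord2 (z : R * R) (i : 'I_2) : R := tnth [tuple z.1; z.2] i.

Definition coord3 (w : R * R * R) (i : 'I_3) : R :=
  tnth [tuple w.1.1; w.1.2; w.2] i.

End Geometry.

Arguments cone {R}.
Arguments disc {R}.

Section DensityMeasure.
Context d (T : measurableType d) (R : realType).
Variables (mu : {measure set T -> \bar R}) (f : T -> R).
Hypotheses (f_ge0 : forall x, 0 <= f x) (mf : measurable_fun setT f).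

Definition density_measure (_ : forall x, 0 <= f x)
    (_ : measurable_fun setT f) (A : set T) : \bar R :=
  (\int[mu]_(x in A) (f x)%:E)%E.

Let nu := density_measure f_ge0 mf.

Let nu0 : nu set0 = 0%E.
Proof. by rewrite /nu /density_measure integral_set0. Qed.

Let nu_ge0 A : (0 <= nu A)%E.
Proof. by apply: integral_ge0 => x _; rewrite lee_fin. Qed.

Let nu_sigma_additive : semi_sigma_additive nu.
Proof.
apply: semi_sigma_additive_nng_induced => [|x]; last by rewrite lee_fin.
exact/measurable_EFinP.
Qed.

HB.instance Definition _ :=
  isMeasure.Build _ _ _ nu nu0 nu_ge0 nu_sigma_additive.

End DensityMeasure.

(* measurableTypeR R is R, with the Borel sigma-algebra on which the library
   defines lebesgue_measure. *)
Notation plane R := (measurableTypeR R * measurableTypeR R)%type.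

Section Measures.
Variables (R : realType) (gamma : R).

Definition lebesgue2 : {measure set (plane R) -> \bar R} :=
  (@lebesgue_measure R \x @lebesgue_measure R)%E.

(* The value of the power at the base 0 only matters on a null set. *)
Definition nu_density : R * R -> R :=
  (fun z => (gamma + 1) / (2 * pi) * (1 - z.1) `^ gamma)
    \_ (`[0, 1] `*` `[0, 2 * pi[).

Definition mu_density : R * R -> R :=
  (fun z => (gamma + 1) / pi * (1 - z.1 ^+ 2 - z.2 ^+ 2) `^ gamma) \_ disc.

Hypothesis gamma_gtN1 : -1 < gamma.

Lemma nu_density_ge0 z : 0 <= nu_density z.
Proof.
apply: restrict_ge0 => {}z _; rewrite mulr_ge0 ?powR_ge0// divr_ge0//.
  by rewrite -lerBlDr sub0r ltW.
by rewrite mulr_ge0// pi_ge0.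
Qed.

Lemma mu_density_ge0 z : 0 <= mu_density z.
Proof.
apply: restrict_ge0 => {}z _; rewrite mulr_ge0 ?powR_ge0// divr_ge0 ?pi_ge0//.
by rewrite -lerBlDr sub0r ltW.
Qed.

Lemma measurable_nu_density :
  measurable_fun (setT : set (plane R)) nu_density.
Proof.
apply/(measurable_restrictT _ _).1; first exact: measurableX.
apply: measurable_funTS; apply: measurable_funM => //.
apply: (measurableT_comp (measurable_powR gamma)).
exact: measurable_funB.
Qed.

Lemma measurable_mu_density : measurable_fun (setT : set (plane R)) mu_density.
Proof.
have msq1 : measurable_fun setT (fun z : plane R => z.1 ^+ 2).
  exact: measurable_funX.
have msq2 : measurable_fun setT (fun z : plane R => z.2 ^+ 2).
  exact: measurable_funX.
apply/(measurable_restrictT _ _).1.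
  have -> : (@disc R) = (fun z : R * R => z.1 ^+ 2 + z.2 ^+ 2) @^-1` `]-oo, 1].
    by apply/seteqP; split => z; rewrite /disc/= in_itv.
  rewrite -[X in measurable X]setTI.
  by apply: (measurable_funD msq1 msq2).
apply: measurable_funTS; apply: measurable_funM => //.
apply: (measurableT_comp (measurable_powR gamma)).
by apply: measurable_funB => //; apply: measurable_funB.
Qed.

Lemma measurable_cone_param :
  measurable_fun (setT : set (plane R)) (@cone_param R).
Proof.
have mc : measurable_fun setT (fun z : plane R => cos z.2).
  apply: measurableT_comp => //.
  by apply: continuous_measurable_fun; exact: continuous_cos.
have ms : measurable_fun setT (fun z : plane R => sin z.2).
  apply: measurableT_comp => //.
  by apply: continuous_measurable_fun; exact: continuous_sin.
by apply: measurable_fun_pair => //=; apply: measurable_fun_pair => //=;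
  apply: measurable_funM.
Qed.

(* The image on the cone of the measure given in the parameters (t, phi). *)
Definition nuV : set (R * R * R) -> \bar R :=
  pushforward (density_measure lebesgue2 nu_density_ge0 measurable_nu_density)
    (@cone_param R).

Let nuV0 : nuV set0 = 0%E.
Proof. by rewrite /nuV /pushforward preimage_set0 measure0. Qed.

Let nuV_ge0 A : (0 <= nuV A)%E.
Proof.
by apply: integral_ge0 => z _; rewrite lee_fin nu_density_ge0.
Qed.

Let nuV_sigma_additive : semi_sigma_additive nuV.
Proof.
move=> F mF tF mUF; rewrite /nuV /pushforward preimage_bigcup.
apply: measure_semi_sigma_additive.
- by move=> n; rewrite -[X in measurable X]setTI; exact: measurable_cone_param.
- apply/trivIsetP => /= i j _ _ ij; rewrite -preimage_setI.
  by move/trivIsetP : tF => /(_ _ _ _ _ ij) ->//; rewrite preimage_set0.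
- rewrite -preimage_bigcup -[X in measurable X]setTI.
  exact: measurable_cone_param.
Qed.

HB.instance Definition _ :=
  isMeasure.Build _ _ _ nuV nuV0 nuV_ge0 nuV_sigma_additive.

Definition muB : set (plane R) -> \bar R :=
  density_measure lebesgue2 mu_density_ge0 measurable_mu_density.

HB.instance Definition _ := Measure.on muB.

End Measures.

(* The scalars are K = R (with iota the identity) or K = R[i] (with iota the
   inclusion). A function on a subset A of T is represented by its extension by
   zero to T, so that it can be integrated against a measure on T. *)
Section PolynomialSpaces.
Variables (R : realType) (K : comNzRingType) (iota : R -> K).

Definition polyrestr (T : Type) (n : nat) (coord : T -> 'I_n -> R) (A : set T)
    (p : mpoly n K) : T -> K :=
  patch (fun=> 0) A (fun z => meval (iota \o coord z) p).

Definition Pi (T : Type) (n : nat) (coord : T -> 'I_n -> R) (A : set T)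
    (m : nat) : set (T -> K) :=
  [set polyrestr coord A p | p in [set p | (mpsize p <= m.+1)%N]].

Definition PiV (m : nat) : set (R * R * R -> K) := Pi (@coord3 R) cone m.

Definition PiB (m : nat) : set (R * R -> K) := Pi (@coord2 R) disc m.

Definition PiB_even (m : nat) : set (R * R -> K) :=
  [set f | PiB m f /\ forall z, disc z -> f (- z) = f z].

End PolynomialSpaces.

(* As Q z lies in the cone if and only if z lies in the disc, this sends
   functions extended by zero outside the cone to functions extended by zero
   outside the disc. *)
Definition pullback (R : realType) (K : Type) (f : R * R * R -> K) :
  R * R -> K := f \o @Q R.

Section InnerProducts.
Context d (T : measurableType d) (R : realType).
Variable mu : {measure set T -> \bar R}.

Definition L2 : set (T -> R) := [set f | f \in Lfun mu 2%:E].

Definition dot (f g : T -> R) : R := \int[mu]_x (f x * g x).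

Definition L2C : set (T -> R[i]) :=
  [set f | L2 (fun x => complex.Re (f x)) /\ L2 (fun x => complex.Im (f x))].

Definition dotC (f g : T -> R[i]) : R[i] :=
  Complex (\int[mu]_x complex.Re (f x * conjc (g x)))
          (\int[mu]_x complex.Im (f x * conjc (g x))).

End InnerProducts.

(* Main.v *)
(* Pulled back by [Q], the cone coordinates become the quadratic forms
   [u ^ 2 - v ^ 2], [2 u v], [u ^ 2 + v ^ 2], which span all binary quadratic
   forms; so every monomial of even degree [2 k] in [u, v] is a polynomial of
   degree at most [k] in them, and [Q] maps the disc onto the cone.
   Unitarity holds because [nuV] is the image of [muB] by [Q]. By Tonelli and
   evenness in [u] it suffices to integrate over [u > 0], where the
   substitutions [v = u s], then [t = (1 + s ^ 2) u ^ 2] at fixed [s], then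
   [phi = 2 atan s] turn [Q (u, v)] into [cone_param (t, phi)] and [du dv] into
   [dt dphi / 4]; only one-dimensional changes of variables are needed. *)

(* In complex notation [Q] is squaring, with the modulus of the square kept as third coordinate. It
   is two-to-one away from the origin and doubles the polar angle, so the slope [s = v / u] equals
   [tan (phi / 2)]; this is why [2 * atan s] is the angle on the cone. The weight of [muB] depends
   only on [t = u ^ 2 + v ^ 2]. It can therefore be absorbed in an arbitrary nonnegative [F] on the
   cone, and only Lebesgue measure has to be transported. The factor [1 / 4] of the half-plane,
   doubled by evenness, leaves [1 / 2], which is exactly the ratio of the normalizing constants
   [(gamma + 1) / (2 * pi)] and [(gamma + 1) / pi]. For [gamma < 0] the densities are unbounded, so
   the changes of variables are proved for nonnegative measurable functions with values in the
   extended reals. Integrability enters only at the end: polynomials are bounded on the cone and on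
   the disc, and both measures have mass 1. *)
Require Import Defs.
From mathcomp Require Import all_boot all_order all_algebra.
From mathcomp Require Import -(notations) mpoly.
From mathcomp Require Import all_classical all_reals all_analysis.
From mathcomp Require Import measurable_realfun.
From mathcomp Require Import complex.
From mathcomp Require Import ring lra.

Set Implicit Arguments.
Unset Strict Implicit.
Unset Printing Implicit Defensive.
Import Order.TTheory GRing.Theory Num.Theory.
Import numFieldNormedType.Exports.

Local Open Scope classical_set_scope.
Local Open Scope ring_scope.

(** * Polynomials *)

Section Degree.
Context (n : nat) (K : comNzRingType).
Implicit Types p q : mpoly n K.

Definition mpdeg_le (d : nat) : set (mpoly n K) :=
  [set p | (mpsize p <= d.+1)%N].

Lemma mpdeg_le_weak d e p : (d <= e)%N -> mpdeg_le d p -> mpdeg_le e p.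
Proof. by move=> de /leq_trans; apply. Qed.

Lemma mpdeg_leD d p q : mpdeg_le d p -> mpdeg_le d q -> mpdeg_le d (p + q).
Proof.
by move=> dp dq; rewrite /mpdeg_le /= (leq_trans (mmeasureD_le _ _ _))// geq_max dp.
Qed.

Lemma mpdeg_leZ d c p : mpdeg_le d p -> mpdeg_le d (c *: p).
Proof. by apply: leq_trans; exact: mmeasureZ_le. Qed.

Lemma mpdeg_le_sum d (I : eqType) (r : seq I) (P : pred I)
    (F : I -> mpoly n K) :
  (forall i, i \in r -> P i -> mpdeg_le d (F i)) ->
  mpdeg_le d (\sum_(i <- r | P i) F i).
Proof.
move=> dF; rewrite big_seq_cond; apply: big_ind => [|p q|i /andP[]]; last exact: dF.
- by rewrite /mpdeg_le /= mmeasure0.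
- exact: mpdeg_leD.
Qed.

Lemma mpdeg_leM d e p q :
  mpdeg_le d p -> mpdeg_le e q -> mpdeg_le (d + e) (p * q).
Proof.
rewrite /mpdeg_le/= => dp dq; rewrite mmeasureE; apply/bigmax_leqP_seq => m.
move=> /msuppM_le /allpairsP[[m1 m2]/= [m1p m2q ->]] _.
rewrite mdegD ltnS leq_add// -ltnS; [apply: leq_trans dp|apply: leq_trans dq];
  exact: (@mmeasure_mnm_lt _ _ mdeg).
Qed.

Lemma mpdeg_leC c : mpdeg_le 0 (mpolyC n c).
Proof. by rewrite /mpdeg_le /= mmeasureC; case: (_ == _). Qed.

Lemma mpdeg_le_var i : mpdeg_le 1 (mpolyX K (mnm1 i)).
Proof. by rewrite /mpdeg_le /= mmeasureX /= mdeg1. Qed.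

Lemma mpdeg_leXn d p k : mpdeg_le d p -> mpdeg_le (k * d) (p ^+ k).
Proof.
move=> dp; elim: k => [|k IHk]; last by rewrite exprS mulSn; exact: mpdeg_leM.
by rewrite expr0 -mpolyC1; exact: mpdeg_leC.
Qed.

Lemma mpdeg_le_prod (I : Type) (r : seq I) (d : I -> nat) (F : I -> mpoly n K) :
  (forall i, mpdeg_le (d i) (F i)) ->
  mpdeg_le (\sum_(i <- r) d i) (\prod_(i <- r) F i).
Proof.
move=> dF; apply: (big_ind2 mpdeg_le) => [|d1 p1 d2 p2|i _]; last exact: dF.
- by rewrite -mpolyC1; exact: mpdeg_leC.
- exact: mpdeg_leM.
Qed.

Lemma mpdeg_le_comp k d e (lq : k.-tuple (mpoly n K)) (p : mpoly k K) :
  (forall i, mpdeg_le e (tnth lq i)) -> (mpsize p <= d.+1)%N ->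
  mpdeg_le (e * d) (comp_mpoly lq p).
Proof.
move=> elq dp; rewrite comp_mpolyE; apply: mpdeg_le_sum => m mp _.
apply: mpdeg_leZ; apply: (@mpdeg_le_weak (\sum_(i < k) m i * e)).
  rewrite -big_distrl/= mulnC leq_mul2l -mdegE -ltnS (leq_trans _ dp) ?orbT//.
  exact: (@mmeasure_mnm_lt _ _ mdeg).
by apply: mpdeg_le_prod => i; exact: mpdeg_leXn.
Qed.

Lemma meval_sum (v : 'I_n -> K) (I : Type) (r : seq I) (P : pred I)
    (F : I -> mpoly n K) :
  meval v (\sum_(i <- r | P i) F i) = \sum_(i <- r | P i) meval v (F i).
Proof. exact: raddf_sum. Qed.

End Degree.

(** * Fibres and image of [Q] *)

Section QGeometry.
Variable R : realType.
Implicit Types (z : R * R) (w : R * R * R).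

(** The equation of the cone is the identity [(u ^ 2 - v ^ 2) ^ 2 + (2 u v) ^ 2 = (u ^ 2 + v ^ 2) ^
    2], and [0 <= t] is automatic, so only [t <= 1] constrains [z]. *)
Lemma cone_Q z : cone (Q z) <-> disc z.
Proof.
rewrite /cone /disc /Q/=; split => [[_ /andP[]]//|z1].
by split; [ring|rewrite z1 addr_ge0// sqr_ge0].
Qed.

Lemma QN z : Q (- z) = Q z.
Proof. by case: z => u v; rewrite /Q/= !sqrrN !mulrN mulNr opprK. Qed.

(** The preimage is a square root of the complex number [x + i y] of modulus [t]: its coordinates
    are [sqrt ((t + x) / 2)] and, up to sign, [sqrt ((t - x) / 2)]. *)
Lemma Q_surj w : cone w -> exists2 z, disc z & Q z = w.
Proof.
case: w => [[x y] t] [/= xyt /andP[t0 t1]].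
have xt : `|x| <= t.
  by rewrite -(ger0_norm t0) -ler_sqr ?nnegrE// !real_normK ?num_real//
    -xyt lerDl sqr_ge0.
have /andP[Ntx lext] : - t <= x <= t by rewrite -ler_norml.
have tx : 0 <= (t + x) / 2 by lra.
have tx' : 0 <= (t - x) / 2 by lra.
(* The sign of [y], with value 1 at [y = 0]: [s ^+ 2 = 1] must hold there too, since for [x = - t]
   the second coordinate carries all of [t]. *)
pose s : R := if 0 <= y then 1 else -1.
have s2 : s ^+ 2 = 1 by rewrite /s; case: ifP; rewrite ?sqrrN expr1n.
have suv : 2 * Num.sqrt ((t + x) / 2) * (s * Num.sqrt ((t - x) / 2)) = y.
  have -> : y = s * `|y|.
    rewrite /s; case: ifPn => y0; first by rewrite mul1r ger0_norm.
    by rewrite ltr0_norm ?ltNge//; ring.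
  rewrite (_ : 2 * _ * _ =
    s * (2 * (Num.sqrt ((t + x) / 2) * Num.sqrt ((t - x) / 2)))); last ring.
  congr (s * _); rewrite -sqrtrM// -sqrtr_sqr.
  have -> : y ^+ 2 = 2 ^+ 2 * ((t + x) / 2 * ((t - x) / 2)).
    by rewrite -(addKr (x ^+ 2) (y ^+ 2)) xyt; field.
  by rewrite [RHS]sqrtrM ?sqr_ge0// sqrtr_sqr ger0_norm.
have Qw : Q (Num.sqrt ((t + x) / 2), s * Num.sqrt ((t - x) / 2)) = (x, y, t).
  rewrite /Q/= suv exprMn s2 mul1r !sqr_sqrtr//.
  by congr (_, _, _); field.
eexists; last exact: Qw.
by apply/cone_Q; rewrite Qw; split => //=; apply/andP.
Qed.

End QGeometry.

(** * Descent of even polynomials along [Q] *)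

Section PullbackBijection.
Context (R : realType) (K : numFieldType) (iota : {rmorphism R -> K}).

Lemma pullback_polyrestr (p : mpoly 3 K) (q : mpoly 2 K) :
  (forall z, meval (iota \o coord2 z) q = meval (iota \o coord3 (Q z)) p) ->
  pullback (polyrestr iota (@coord3 R) cone p) =
  polyrestr iota (@coord2 R) disc q.
Proof.
move=> qp; apply/funext => z; rewrite /pullback /polyrestr /= /patch qp.
by congr (if _ then _ else _); apply/idP/idP; rewrite !inE => /cone_Q.
Qed.

Let X2 (i : 'I_2) : mpoly 2 K := mpolyX K (mnm1 i).
Let X3 (i : 'I_3) : mpoly 3 K := mpolyX K (mnm1 i).

Definition Qpoly : 3.-tuple (mpoly 2 K) :=
  [tuple X2 ord0 ^+ 2 - X2 ord_max ^+ 2; 2%:R *: (X2 ord0 * X2 ord_max);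
         X2 ord0 ^+ 2 + X2 ord_max ^+ 2].

Lemma mpdeg_le_Qpoly i : mpdeg_le 2 (tnth Qpoly i).
Proof.
have dX j : mpdeg_le 2 (X2 j ^+ 2).
  by apply: (@mpdeg_leXn _ _ 1 _ 2); exact: mpdeg_le_var.
have : tnth Qpoly i \in Qpoly := mem_tnth _ _.
rewrite !inE => /or3P[] /eqP ->.
- by rewrite -scaleN1r; apply: mpdeg_leD => //; apply: mpdeg_leZ.
- by apply: mpdeg_leZ; apply: (@mpdeg_leM _ _ 1 1); exact: mpdeg_le_var.
- exact: mpdeg_leD.
Qed.

Lemma meval_Qpoly z i :
  meval (iota \o coord2 z) (tnth Qpoly i) = iota (coord3 (Q z) i).
Proof.
rewrite /coord3 /Qpoly; case: i => [[|[|[|//]]] ?]; rewrite !(tnth_nth 0)/=.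
all: rewrite ?expr2 ?(mevalD, mevalZ) ?mevalN ?mevalM !mevalXU/= /coord2
  !(tnth_nth 0)/=.
- by rewrite rmorphB !rmorphM.
- by rewrite !rmorphM rmorph_nat mulrA.
- by rewrite rmorphD !rmorphM.
Qed.

Lemma pullback_PiV m f :
  PiV iota m f -> PiB_even iota (2 * m) (pullback f).
Proof.
move=> [p dp <-]; split.
  exists (comp_mpoly Qpoly p).
    by apply: mpdeg_le_comp => //; exact: mpdeg_le_Qpoly.
  rewrite -(@pullback_polyrestr p)// => z.
  by rewrite comp_mpoly_meval; apply: meval_eq => i; rewrite meval_Qpoly.
by move=> z _; rewrite /pullback /comp QN.
Qed.

Lemma pullback_inj (f g : R * R * R -> K) m :
  PiV iota m f -> PiV iota m g -> pullback f = pullback g -> f = g.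
Proof.
move=> [p _ <-] [q _ <-] /funeqP fg; apply/funext => w.
have [wV|wV] := pselect (cone w).
  by have [z _ <-] := Q_surj wV; exact: fg.
by rewrite /polyrestr !patchN// notin_setE.
Qed.

(* On the cone, [u ^ 2 = (t + x) / 2], [v ^ 2 = (t - x) / 2] and [u v = y / 2],
   so this descends the monomial [u ^ i v ^ j] when [i + j] is even. *)
Definition descend_monomial (m : multinom 2) : mpoly 3 K :=
  (2%:R^-1 *: (X3 ord_max + X3 ord0)) ^+ (m ord0)./2 *
  (2%:R^-1 *: (X3 ord_max - X3 ord0)) ^+ (m ord_max)./2 *
  (2%:R^-1 *: X3 (inord 1)) ^+ odd (m ord0).

Lemma mdeg2 (m : multinom 2) : mdeg m = (m ord0 + m ord_max)%N.
Proof.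
by rewrite mdegE !big_ord_recl big_ord0 addn0; congr (m _ + m _)%N; exact/val_inj.
Qed.

Lemma mpdeg_le_descend (m : multinom 2) :
  ~~ odd (mdeg m) -> mpdeg_le (mdeg m)./2 (descend_monomial m).
Proof.
rewrite mdeg2 => ev.
(* When both exponents are odd, the two halves lose one in total; the single factor [y / 2] of
   [descend_monomial] accounts for it. *)
have -> : (m ord0 + m ord_max)./2 =
    ((m ord0)./2 * 1 + (m ord_max)./2 * 1 + odd (m ord0) * 1)%N.
  move: ev; rewrite halfD oddD !muln1 => ev; rewrite addnC; congr addn.
  by case: (odd (m ord0)) ev; case: odd.
apply: mpdeg_leM; first apply: mpdeg_leM; apply: mpdeg_leXn; apply: mpdeg_leZ.
- by apply: mpdeg_leD; exact: mpdeg_le_var.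
- by rewrite -scaleN1r; apply: mpdeg_leD; [|apply: mpdeg_leZ]; exact: mpdeg_le_var.
- exact: mpdeg_le_var.
Qed.

Lemma meval_descend (m : multinom 2) z : ~~ odd (mdeg m) ->
  meval (iota \o coord3 (Q z)) (descend_monomial m) =
  meval (iota \o coord2 z) (mpolyX K m).
Proof.
(* Even total degree means that the exponents have the same parity, so [odd (m ord0)] is also the
   remainder of the second exponent. *)
rewrite mdeg2 oddD negb_add => /eqP ev.
rewrite mevalX !big_ord_recl big_ord0 mulr1.
rewrite (_ : lift ord0 ord0 = ord_max :> 'I_2); last exact/val_inj.
rewrite !(mevalM, rmorphXn)/= !(mevalZ, mevalD, mevalN, mevalXU)/=.
rewrite /coord2 /coord3 !(tnth_nth 0)/= inordK//=.
set a := iota z.1; set b := iota z.2.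
rewrite !(rmorphD, rmorphN, rmorphM, rmorphXn, rmorph_nat)/= -/a -/b.
rewrite (_ : 2^-1 * (a ^+ 2 + b ^+ 2 + (a ^+ 2 - b ^+ 2)) = a ^+ 2); last by field.
rewrite (_ : 2^-1 * (a ^+ 2 + b ^+ 2 - (a ^+ 2 - b ^+ 2)) = b ^+ 2); last by field.
rewrite (_ : 2^-1 * (2 * a * b) = a * b); last by field.
rewrite -!exprM -[in RHS](odd_double_half (m ord0))
  -[in RHS](odd_double_half (m ord_max)).
by rewrite -ev -!muln2 ![(2 * _)%N]mulnC !exprD exprMn; ring.
Qed.

Lemma meval_monomialN (m : multinom 2) z :
  meval (iota \o coord2 (- z)) (mpolyX K m) =
  (-1) ^+ mdeg m * meval (iota \o coord2 z) (mpolyX K m).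
Proof.
rewrite !mevalX mdegE (big_morph (fun k => (-1) ^+ k) (@exprD K _) (expr0 _)).
rewrite -big_split.
apply: eq_bigr => i _; rewrite [RHS]/= -exprMn mulN1r -rmorphN/=.
by rewrite /coord2; case: i => [[|[|//]] ?]; rewrite !(tnth_nth 0).
Qed.

(** Split a representing polynomial into its parts of even and odd degree. Evenness of [f] gives
    [od = - od] at each point of the disc, so [od] vanishes there in characteristic 0. Hence [f] is
    the restriction of [ev], which descends monomial by monomial. *)
Lemma PiB_even_pullback m f :
  PiB_even iota (2 * m) f -> exists2 g, PiV iota m g & pullback g = f.
Proof.
move=> [[p dp <-] evf].
pose ev := \sum_(k <- msupp p | ~~ odd (mdeg k)) mcoeff k p *: mpolyX K k.
pose q := \sum_(k <- msupp p | ~~ odd (mdeg k)) mcoeff k p *: descend_monomial k.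
pose od := \sum_(k <- msupp p | odd (mdeg k)) mcoeff k p *: mpolyX K k.
have p_ev_od : p = ev + od.
  rewrite [LHS]mpolyE (bigID (fun k => ~~ odd (mdeg k)))/=; congr (_ + _).
  by apply: eq_bigl => k; rewrite negbK.
have evN z : meval (iota \o coord2 (- z)) ev = meval (iota \o coord2 z) ev.
  rewrite !meval_sum; apply: eq_bigr => k /negbTE ok.
  by rewrite !mevalZ meval_monomialN -signr_odd ok mul1r.
have odN z : meval (iota \o coord2 (- z)) od = - meval (iota \o coord2 z) od.
  rewrite !meval_sum -sumrN; apply: eq_bigr => k ok.
  by rewrite !mevalZ meval_monomialN -signr_odd ok mulN1r mulrN.
have pev z : disc z -> meval (iota \o coord2 z) p = meval (iota \o coord2 z) ev.
  move=> dz; have dNz : disc (- z) by rewrite /disc/= !sqrrN.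
  have := evf z dz; rewrite /polyrestr !patchT ?inE//.
  rewrite p_ev_od !mevalD evN odN => /addrI/eqP.
  by rewrite eq_sym -addr_eq0 -mulr2n mulrn_eq0/= => /eqP ->; rewrite addr0.
exists (polyrestr iota (@coord3 R) cone q).
  exists q => //; apply: mpdeg_le_sum => k kp ok; apply: mpdeg_leZ.
  apply: mpdeg_le_weak (mpdeg_le_descend ok).
  have := leq_trans (@mmeasure_mnm_lt _ _ mdeg _ _ kp) dp; rewrite ltnS.
  by move=> /half_leq; rewrite mul2n doubleK.
rewrite (@pullback_polyrestr _ ev); last first.
  move=> z; rewrite !meval_sum; apply: eq_bigr => k ok.
  by rewrite !mevalZ meval_descend.
apply/funext => z; rewrite /polyrestr /patch; case: ifPn => // /[!inE] dz.
by rewrite pev.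
Qed.

Lemma pullback_bij m :
  set_bij (PiV iota m) (PiB_even iota (2 * m)) (@pullback R K).
Proof.
split.
- by move=> f; exact: pullback_PiV.
- by move=> f g; rewrite !inE; exact: pullback_inj.
- by move=> f /PiB_even_pullback[g gV <-]; exists g.
Qed.

End PullbackBijection.

(** * One-dimensional changes of variables *)

Section DensityIntegral.
Context d (T : measurableType d) (R : realType).
Variables (mu : {measure set T -> \bar R}) (f : T -> R).
Hypotheses (f_ge0 : forall x, 0 <= f x) (mf : measurable_fun setT f).

Local Open Scope ereal_scope.
Import HBNNSimple.

(** For a simple function both sides are the same finite sum over its level sets; monotone
    convergence, applied on each side to an increasing simple approximation of [h], gives the
    general case. *)
Lemma ge0_integral_density (h : T -> \bar R) :
  measurable_fun setT h -> (forall x, 0 <= h x) ->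
  \int[density_measure mu f_ge0 mf]_x h x = \int[mu]_x (h x * (f x)%:E).
Proof.
move=> mh h0; pose h_ := nnsfun_approx measurableT mh.
have mEf : measurable_fun setT (EFin \o f) by exact/measurable_EFinP.
have h_h x : (EFin \o h_^~ x) n @[n --> \oo] --> h x.
  by apply: cvg_nnsfun_approx.
transitivity (limn (fun n => \int[density_measure mu f_ge0 mf]_x (h_ n x)%:E)).
  rewrite -monotone_convergence//.
  - by apply: eq_integral => x _; apply/esym/cvg_lim => //; exact: h_h.
  - by move=> n; exact/measurable_EFinP.
  - by move=> n x _; rewrite lee_fin.
  - by move=> x _ m n mn; rewrite lee_fin; exact/lefP/nd_nnsfun_approx.
transitivity (limn (fun n => \int[mu]_x ((h_ n x)%:E * (f x)%:E))); last first.
  rewrite -monotone_convergence//.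
  - apply: eq_integral => x _; apply/cvg_lim => //.
    exact: (cvgeZr _ (h_h x)).
  - by move=> n; apply: emeasurable_funM => //; exact/measurable_EFinP.
  - by move=> n x _; rewrite mule_ge0 ?lee_fin.
  - move=> x _ m n mn; rewrite lee_wpmul2r ?lee_fin//.
    exact/lefP/nd_nnsfun_approx.
congr (limn _); apply/funext => n.
have mh_ r : measurable (h_ n @^-1` [set r]) by exact: measurable_funPTI.
rewrite integralT_nnsfun sintegralE.
transitivity (\int[mu]_x
    \sum_(r \in range (h_ n)) (r%:E * ((f x)%:E * (\1_(h_ n @^-1` [set r]) x)%:E))).
  rewrite ge0_integral_fsum//; last 2 first.
  - move=> r; apply: measurable_funeM; apply: emeasurable_funM => //.
    exact/measurable_EFinP.
  (* A negative [r] is not a value of [h_ n]: its level set is empty and its term is 0. *)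
  - move=> r x _; have [r0|r0] := leP 0%R r.
      by rewrite !mule_ge0 ?lee_fin.
    by rewrite preimage_nnfun0// indic0 !mule0.
  apply: eq_fsbigr => r; rewrite inE => -[x _ <-].
  rewrite ge0_integralZl ?lee_fin//; last 2 first.
  - by apply: emeasurable_funM => //; exact/measurable_EFinP.
  - by move=> y _; rewrite mule_ge0 ?lee_fin.
  congr (_ * _); rewrite /density_measure [LHS]integral_mkcond.
  apply: eq_integral => y _; rewrite patchE indicE.
  by case: ifPn; rewrite ?mule1 ?mule0.
apply: eq_integral => x _.
rewrite [in RHS]fimfunE -fsumEFin// ge0_mule_fsuml; last first.
  by move=> r; rewrite EFinM nnfun_muleindic_ge0.
by apply: eq_fsbigr => r _; rewrite EFinM -muleA; congr (_ * _); exact: muleC.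
Qed.

End DensityIntegral.

(** * Substitution for nonnegative measurable functions: segments, then increasing unions of
    segments *)

Section Substitution.
Context (R : realType).
Local Notation mu := (@lebesgue_measure R).
Implicit Types (phi dphi : R -> R) (h : R -> \bar R).

(** The case [a = b] is included because [lebesgue_image] applies this to [[x, b]] with [x] possibly
    equal to [b]. *)
Let integral_deriv_itv phi dphi (a b : R) :
  {in `[a, b], forall x : R, is_derive x 1 phi (dphi x)} ->
  {in `[a, b], continuous dphi} -> a <= b ->
  (\int[mu]_(x in `[a, b]) (dphi x)%:E = (phi b - phi a)%:E)%E.
Proof.
move=> dphiE cdphi; rewrite le_eqVlt => /predU1P[<-|ab].
  by rewrite set_itv1 integral_set1 subrr.
have sub x : x \in `]a, b[ -> x \in `[a, b] by exact: subset_itv_oo_cc.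
have cphi x : x \in `[a, b] -> {for x, continuous phi}.
  move=> /dphiE ?; apply: differentiable_continuous.
  by apply/derivable1_diffP; exact: ex_derive.
rewrite (@continuous_FTC2 _ dphi phi)// ?EFinB//.
- by apply/continuous_in_subspaceT => x /[!inE]; exact: cdphi.
- split; first by move=> x /sub /dphiE ?; exact: ex_derive.
  + by apply: cvg_at_right_filter; apply: cphi; rewrite bound_itvE ltW.
  + by apply: cvg_at_left_filter; apply: cphi; rewrite bound_itvE ltW.
- by move=> x /sub /dphiE ?; rewrite derive1E derive_val.
Qed.

Section segment.
Variables (phi dphi : R -> R) (a b : R).
Hypotheses (mphi : measurable_fun setT phi) (mdphi : measurable_fun setT dphi).
Hypothesis dphiE : {in `[a, b], forall x : R, is_derive x 1 phi (dphi x)}.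
Hypothesis cdphi : {in `[a, b], continuous dphi}.
Hypothesis dphi_gt0 : {in `[a, b], forall x, 0 < dphi x}.
Hypothesis ab : a < b.

Let cphi : {within `[a, b], continuous phi}.
Proof.
by apply: derivable_within_continuous => x /dphiE ?; exact: ex_derive.
Qed.

Let le_phi : {in `[a, b] &, {mono phi : x y / x <= y}}.
Proof.
apply: le_mono_in; apply: gtr0_derive1_lt_cc => // x.
  by move=> /subset_itv_oo_cc /dphiE ?; exact: ex_derive.
move=> /subset_itv_oo_cc xab; have ? := dphiE xab.
by rewrite derive1E derive_val dphi_gt0.
Qed.

Lemma image_segment_gt0_derive : phi @` `[a, b] = `[phi a, phi b]%classic.
Proof.
have aab : a \in `[a, b] by rewrite bound_itvE ltW.
have bab : b \in `[a, b] by rewrite bound_itvE ltW.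
apply/seteqP; split => [_ [x xab <-]|].
  by rewrite /= in_itv/= !le_phi//; move: xab; rewrite /= in_itv.
apply: segment_continuous_le_surjective => //; first exact: ltW.
by rewrite le_phi// ltW.
Qed.

(** A density must be nonnegative on the whole line, whereas [dphi] is known to be so only on the
    segment. *)
Let dphiK : R -> R := dphi \_ `[a, b].

Let dphiK_ge0 x : 0 <= dphiK x.
Proof. by apply: restrict_ge0 => y yab; rewrite ltW// dphi_gt0. Qed.

Let mdphiK : measurable_fun setT dphiK.
Proof.
by apply/(measurable_restrictT _ _).1 => //; exact: measurable_funTS.
Qed.

Let nu : {measure set (measurableTypeR R) -> \bar R} :=
  density_measure mu dphiK_ge0 mdphiK.

Let nuE A : nu A = (\int[mu]_(x in A `&` `[a, b]) (dphi x)%:E)%E.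
Proof.
rewrite /nu /= /density_measure integral_mkcondr; apply: eq_integral => x _.
by rewrite /dphiK restrict_EFin.
Qed.

(* Both sides are finite measures on the image of [phi], and by the fundamental
   theorem of calculus they agree on the rays [`[c, +oo[]. *)
Let lebesgue_image A : measurable A -> A `<=` phi @` `[a, b] ->
  pushforward nu phi A = mu A.
Proof.
move=> mA; rewrite image_segment_gt0_derive => sA.
have mab : measurable (`[phi a, phi b]%classic : set (measurableTypeR R)) by [].
(* [nu] has no mass outside [[a, b]]; restricting [mu] to the image segment turns the claim into an
   equality of two measures on the line. *)
suff /(_ A mA) : forall B : set (measurableTypeR R), measurable B ->
    pushforward nu (phi : measurableTypeR R -> measurableTypeR R) B = mrestr mu mab B.
  by rewrite /mrestr setIidl.
have nu_itv x : x \in `[a, b] ->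
    nu `[x, b]%classic = mu `[phi x, phi b]%classic.
  move=> xab; have [ax xb] : a <= x /\ x <= b by split; rewrite (itvP xab).
  have bab : b \in `[a, b] by rewrite bound_itvE ltW.
  have sub z : z \in `[x, b] -> z \in `[a, b].
    by rewrite !in_itv/= => /andP[xz ->]; rewrite (le_trans ax).
  rewrite nuE setIidl; last exact: sub.
  rewrite (@integral_deriv_itv phi)//; last 2 first.
  - by move=> z /sub; exact: dphiE.
  - by move=> z /sub; exact: cdphi.
  rewrite lebesgue_measure_itv/= lte_fin; case: ltgtP => [//| |->].
    by rewrite ltNge le_phi// xb.
  by rewrite subrr.
have rays B : RGenCInfty.G B -> pushforward nu phi B = mrestr mu mab B.
  move=> [c ->]; have [|cb] := ltP (phi b) c.
    move=> bc; rewrite /pushforward nuE /mrestr.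
    have -> : phi @^-1` `[c, +oo[ `&` `[a, b] = set0.
      apply/seteqP; split => // y []/=; rewrite in_itv/= andbT => cy yab.
      have : phi y <= phi b.
        rewrite le_phi// ?bound_itvE ?(ltW ab)//.
        by move: yab; rewrite /= in_itv => /andP[].
      by move=> /(le_trans cy)/(lt_le_trans bc); rewrite ltxx.
    have -> : `[c, +oo[ `&` `[phi a, phi b] = set0.
      apply/seteqP; split => // y []/=; rewrite !in_itv/= andbT => cy /andP[_ yb].
      by have := lt_le_trans bc (le_trans cy yb); rewrite ltxx.
    by rewrite integral_set0 measure0.
  (* On the image segment the threshold [c] may be replaced by some [phi x]: take [x = a] if [c] is
     at most [phi a], and otherwise apply the intermediate value theorem. *)
  have [x xab cx] : exists2 x, x \in `[a, b] &
      {in `[phi a, phi b], forall z, (c <= z) = (phi x <= z)}.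
    have [ca|ac] := leP c (phi a).
      exists a => [|z]; first by rewrite bound_itvE ltW.
      by rewrite in_itv/= => /andP[az _]; rewrite az (le_trans ca).
    have [|x xab phix] := IVT (ltW ab) cphi (v := c).
      by rewrite ge_min le_max (ltW ac) cb orbT.
    by exists x => // z _; rewrite phix.
  rewrite /pushforward nuE /mrestr.
  have ax : a <= x by rewrite (itvP xab).
  have phi_in y : `[a, b]%classic y -> phi y \in `[phi a, phi b].
    by move=> yab; have : (phi @` `[a, b]) (phi y) by [exists y];
      rewrite image_segment_gt0_derive.
  have -> : phi @^-1` `[c, +oo[ `&` `[a, b] = `[x, b]%classic `&` `[a, b].
    apply/seteqP; split => y [+ yab]; have phiy := phi_in _ yab.
      have yab' : a <= y <= b by move: yab; rewrite /= in_itv.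
      rewrite /= !in_itv/= andbT cx// le_phi// => xy.
      by split; rewrite ?xy; case/andP: yab'.
    by rewrite /= !in_itv/= andbT cx// le_phi// => /andP[-> _]; split.
  have -> : `[c, +oo[ `&` `[phi a, phi b] = `[phi x, phi b]%classic.
    apply/seteqP; split => z /=; rewrite !in_itv/= andbT.
      by move=> [+ zab]; rewrite cx ?in_itv// => ->; case/andP: zab.
    move=> /andP[xz zb]; have zab : phi a <= z <= phi b.
      by rewrite zb andbT (le_trans _ xz)// le_phi// bound_itvE ltW.
    by rewrite cx ?in_itv.
  by rewrite -nuE nu_itv.
move=> B mB; apply: (@measure_unique _ R (measurableTypeR R) (@RGenCInfty.G R)
  (fun n => `[- n%:R, +oo[%classic)) => //.
- exact: RGenCInfty.measurableE.
- move=> _ _ [x ->] [y ->]; exists (Num.max x y); apply/seteqP; split => z/=;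
    by rewrite !in_itv/= !andbT ge_max => /andP.
- by move=> n; exists (- n%:R).
- apply/seteqP; split => // x _; exists (Num.truncn `|x|).+1 => //=.
  rewrite in_itv/= andbT lerNl (le_trans _ (ltW (truncnS_gt _)))//.
  by rewrite -normrN ler_norm.
- move=> n; rewrite [ltLHS]rays; last by exists (- n%:R).
  rewrite /= /mrestr; apply: (@le_lt_trans _ _ (mu `[phi a, phi b]%classic)).
    by apply: le_measure; rewrite ?inE//; exact: measurableI.
  by rewrite lebesgue_measure_itv/=; case: ifP => _; rewrite -?EFinB ltry.
Qed.

Local Open Scope ereal_scope.

(** On measurable subsets of the image, [mu] is the pushforward of [nu] by [phi]. So the left side
    is an integral against that pushforward, which is pulled back along [phi] and then rewritten
    with the density [dphiK]. *)
Lemma ge0_integration_by_substitution_segment h :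
  measurable_fun setT h -> (forall x, 0 <= h x) ->
  \int[mu]_(y in phi @` `[a, b]) h y =
  \int[mu]_(x in `[a, b]) (h (phi x) * (dphi x)%:E).
Proof.
move=> mh h0; have mim : measurable (phi @` `[a, b] : set (measurableTypeR R)).
  by rewrite image_segment_gt0_derive.
transitivity (\int[pushforward nu (phi : _ -> measurableTypeR R)]_(y in
    phi @` `[a, b]) h y).
  by apply: eq_measure_integral => A mA sA; exact/esym/lebesgue_image.
rewrite ge0_integral_pushforward//; last exact: measurable_funTS.
rewrite integral_mkcond ge0_integral_density; last 2 first.
- apply/(measurable_restrictT _ _).1; last exact/measurable_funTS/measurableT_comp.
  by rewrite -[X in measurable X]setTI; exact: mphi.
- by move=> x; apply: erestrict_ge0 => y _; exact: h0.
rewrite [RHS]integral_mkcond; apply: eq_integral => x _.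
rewrite /dphiK !patchE/=; have [xab|_] := boolP (x \in `[a, b]%classic).
  by rewrite mem_set//=; exists x => //; exact: set_mem.
by rewrite mule0.
Qed.

End segment.

Local Open Scope ereal_scope.


(* Any nonempty open interval [D] is such an increasing union of segments, on
   each of which [phi] is C^1 up to the boundary. *)
Lemma ge0_integration_by_substitution (phi dphi : R -> R) (D : set R)
    (a b : R^nat) (h : R -> \bar R) :
  D = \bigcup_n `[a n, b n]%classic ->
  {homo a : m n / (m <= n)%N >-> (n <= m)%R} ->
  {homo b : m n / (m <= n)%N >-> (m <= n)%R} ->
  measurable_fun setT phi -> measurable_fun setT dphi ->
  (forall x, D x -> is_derive x (1 : R)%R phi (dphi x)) ->
  (forall x, D x -> {for x, continuous dphi}) ->
  (forall x, D x -> (0 < dphi x)%R) ->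
  measurable_fun setT h -> (forall x, 0 <= h x) ->
  \int[mu]_(y in phi @` D) h y = \int[mu]_(x in D) (h (phi x) * (dphi x)%:E).
Proof.
move=> DE a_ni b_nd mphi mdphi dphiE cdphi dphi_gt0 mh h0.
have sD n x : x \in `[a n, b n] -> D x by rewrite DE => xn; exists n.
have Dn (n : nat) : let K := `[a n, b n]%classic in measurable (phi @` K) /\
    \int[mu]_(y in phi @` K) h y = \int[mu]_(x in K) (h (phi x) * (dphi x)%:E).
  (* Empty and one-point segments are allowed; both exhaustions used below begin with a one-point
     segment. *)
  have [ab|ba|ab] := ltgtP (a n) (b n).
  - have dE : {in `[a n, b n], forall x : R, is_derive x (1 : R)%R phi (dphi x)}.
      by move=> x /sD /dphiE.
    have d0 : {in `[a n, b n], forall x, (0 < dphi x)%R} by move=> x /sD /dphi_gt0.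
    split; first by rewrite (image_segment_gt0_derive dE d0 ab).
    by apply: ge0_integration_by_substitution_segment => // x /sD; exact: cdphi.
  - by rewrite /= set_itv_ge -?ltNge ?bnd_simp// image_set0 !integral_set0.
  - by rewrite /= ab set_itv1 image_set1 !integral_set1.
have hd0 x : D x -> 0 <= h (phi x) * (dphi x)%:E.
  by move=> /dphi_gt0 dx; rewrite mule_ge0// lee_fin ltW.
have ndK : nondecreasing_seq (fun n => `[a n, b n]%classic).
  move=> m n mn; apply/subsetPset => x /=; rewrite !in_itv/= => /andP[ax xb].
  by rewrite (le_trans (a_ni _ _ mn))// (le_trans xb)// b_nd.
rewrite DE image_bigcup.
transitivity (limn (fun n => \int[mu]_(y in phi @` `[a n, b n]) h y)).
  apply/esym/cvg_lim => //; apply: ge0_nondecreasing_set_cvg_integral => //.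
  - move=> m n mn; apply/subsetPset; apply: image_subset; exact/subsetPset/ndK.
  - by move=> n; have [] := Dn n.
  - by move=> n; exact: measurable_funTS.
transitivity (limn (fun n => \int[mu]_(x in `[a n, b n]) (h (phi x) * (dphi x)%:E))).
  by congr (limn _); apply/funext => n; have [] := Dn n.
apply/cvg_lim => //; apply: ge0_nondecreasing_set_cvg_integral => //.
- move=> n; apply: measurable_funTS; apply: emeasurable_funM.
    exact: measurableT_comp.
  exact/measurable_EFinP.
- by move=> n x /sD; exact: hd0.
Qed.

Lemma ge0_integration_by_substitution_setT (phi dphi : R -> R) (h : R -> \bar R) :
  (forall x, is_derive x (1 : R)%R phi (dphi x)) -> continuous dphi ->
  (forall x, (0 < dphi x)%R) ->
  measurable_fun setT h -> (forall x, 0 <= h x) ->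
  \int[mu]_(y in range phi) h y = \int[mu]_x (h (phi x) * (dphi x)%:E).
Proof.
move=> dphiE cdphi dphi_gt0 mh h0.
apply: (@ge0_integration_by_substitution _ _ _ (fun n => - n%:R)%R (fun n => n%:R)) => //.
- apply/esym/seteqP; split => // x _; exists (Num.truncn `|x|).+1 => //=.
  by rewrite in_itv/= -ler_norml ltW// truncnS_gt.
- by move=> m n mn; rewrite lerN2 ler_nat.
- by move=> m n mn; rewrite ler_nat.
- apply: continuous_measurable_fun => x; apply: differentiable_continuous.
  by apply/derivable1_diffP; have ? := dphiE x; exact: ex_derive.
- exact: continuous_measurable_fun.
- by move=> x _; exact: cdphi.
Qed.

Lemma ge0_integration_by_substitution_gt0 (phi dphi : R -> R) (h : R -> \bar R) :
  measurable_fun setT phi -> measurable_fun setT dphi ->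
  (forall x : R, (0 < x)%R -> is_derive x (1 : R)%R phi (dphi x)) ->
  (forall x : R, (0 < x)%R -> {for x, continuous dphi}) ->
  (forall x : R, (0 < x)%R -> (0 < dphi x)%R) ->
  measurable_fun setT h -> (forall x, 0 <= h x) ->
  \int[mu]_(y in phi @` `]0%R, +oo[) h y =
  \int[mu]_(x in `]0%R, +oo[) (h (phi x) * (dphi x)%:E).
Proof.
move=> mphi mdphi dphiE cdphi dphi_gt0 mh h0.
have gt0 (x : R) : `]0%R, +oo[%classic x -> (0 < x)%R by rewrite /= in_itv/= andbT.
apply: (@ge0_integration_by_substitution _ _ _ (fun n => n.+1%:R^-1)%R
  (fun n => n.+1%:R)) => //.
- apply/seteqP; split => x /=.
    rewrite in_itv/= andbT => x0.
    (* The segment from [1 / (n + 1)] to [n + 1] contains [x] once [n + 1] exceeds both [x] and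
       [1 / x]. *)
    exists (maxn (Num.truncn x) (Num.truncn x^-1)) => //=.
    rewrite in_itv/=; apply/andP; split.
      rewrite invf_ple ?posrE// (le_trans (ltW (truncnS_gt _)))//.
      by rewrite ler_nat ltnS leq_maxr.
    by rewrite (le_trans (ltW (truncnS_gt _)))// ler_nat ltnS leq_maxl.
  move=> [n _] /=; rewrite !in_itv/= andbT => /andP[+ _].
  by apply: lt_le_trans; rewrite invr_gt0.
- by move=> m n mn; rewrite lef_pV2 ?posrE// ler_nat.
- by move=> m n mn; rewrite ler_nat.
- by move=> x /gt0; exact: dphiE.
- by move=> x /gt0; exact: cdphi.
- by move=> x /gt0; exact: dphi_gt0.
Qed.

End Substitution.

(** * Transport of the measures by [Q] *)

Section Polar.
Context (R : realType).
Local Notation mu := (@lebesgue_measure R).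
Local Open Scope ereal_scope.

Lemma measurable_Q :
  measurable_fun (setT : set (plane R)) (@Q R : plane R -> R * R * R).
Proof.
have m1 : measurable_fun setT (fun z : plane R => z.1 ^+ 2)%R.
  exact: measurable_funX.
have m2 : measurable_fun setT (fun z : plane R => z.2 ^+ 2)%R.
  exact: measurable_funX.
apply: measurable_fun_pair; last exact: measurable_funD.
apply: measurable_fun_pair; first exact: measurable_funB.
by apply: measurable_funM => //; exact: measurable_funM.
Qed.

(** These are the half-angle formulas: with [s = tan (phi / 2)], the cosine and sine of [phi] are
    [(1 - s ^ 2) / (1 + s ^ 2)] and [2 s / (1 + s ^ 2)], and [t = u ^ 2 + (u s) ^ 2] cancels the
    denominators. *)
Lemma cone_param_atan (s u : R) :
  cone_param (((1 + s ^+ 2) * u ^+ 2)%R, (2 * atan s)%R) = Q (u, (u * s)%R).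
Proof.
have s0 : (1 + s ^+ 2 != 0)%R by rewrite gt_eqF// ltr_pwDl// sqr_ge0.
have cs : (cos (atan s) ^+ 2 = (1 + s ^+ 2)^-1)%R.
  by rewrite cos_atan exprVn sqr_sqrtr// addr_ge0// sqr_ge0.
have sn : (sin (atan s) = s * cos (atan s))%R.
  rewrite -[X in (X * _)%R]atanK /tan divfK// cos_atan invr_eq0 sqrtr_eq0 -ltNge.
  by rewrite ltr_pwDl// sqr_ge0.
have cos2 : (cos (2 * atan s) = (1 - s ^+ 2) / (1 + s ^+ 2))%R.
  by rewrite mulr_natl cos_mulr2n cs; field.
have sin2 : (sin (2 * atan s) = 2 * s / (1 + s ^+ 2))%R.
  by rewrite mulr_natl sin_mulr2n sn mulrCA -expr2 cs; field.
by rewrite /cone_param /Q/= cos2 sin2; congr (_, _, _); field.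
Qed.

Lemma ge0_integral_even (f : R -> \bar R) :
  measurable_fun setT f -> (forall x, 0 <= f x) -> (forall x, f (- x)%R = f x) ->
  \int[mu]_x f x = 2%:E * \int[mu]_(x in `]0%R, +oo[) f x.
Proof.
move=> mf f0 fN.
have <- : `]-oo, 0%R] `|` `]0%R, +oo[ = [set: R].
  by rewrite -setCitvl setUv.
rewrite ge0_integral_setU//; last 2 first.
- exact: measurable_funTS.
- by apply/disj_setPS => x; rewrite /= !in_itv/= andbT => -[]; rewrite leNgt => /negP.
have -> : \int[mu]_(x in `]-oo, 0%R]) f x = \int[mu]_(x in `]0%R, +oo[) f x.
  rewrite integral_itv_obnd_cbnd; last exact: measurable_funTS.
  rewrite ge0_integration_by_substitution0//; apply: eq_integral => x _.
  by rewrite fN.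
by rewrite -mule2n -mule_natl.
Qed.

Lemma ge0_integral_oppr (f : R -> \bar R) :
  measurable_fun setT f -> (forall x, 0 <= f x) ->
  \int[mu]_x f (- x)%R = \int[mu]_x f x.
Proof.
move=> mf f0.
have mN : measurable_fun setT (-%R : measurableTypeR R -> measurableTypeR R).
  exact: oppr_measurable.
transitivity (\int[pushforward mu (-%R : _ -> measurableTypeR R)]_x f x).
  by rewrite ge0_integral_pushforward// preimage_setT.
by apply: eq_measure_integral => A mA _; exact: lebesgue_measureN.
Qed.

Lemma ge0_integral_addr (c : R) (f : R -> \bar R) :
  measurable_fun setT f -> (forall x, 0 <= f x) ->
  \int[mu]_x f (x + c)%R = \int[mu]_x f x.
Proof.
move=> mf f0; have rangeD : range (fun x : R => x + c)%R = [set: R].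
  by apply/seteqP; split => // y _; exists (y - c)%R => //; rewrite subrK.
have dD x : is_derive x (1 : R)%R (fun x => x + c)%R (cst 1%R x).
  by apply: is_derive_eq; rewrite addr0.
rewrite -[in RHS]rangeD (ge0_integration_by_substitution_setT dD)//.
  by apply: eq_integral => x _; rewrite mule1.
by move=> x; exact: cvg_cst.
Qed.

Lemma ge0_integral_onem (f : R -> \bar R) :
  measurable_fun setT f -> (forall x, 0 <= f x) ->
  \int[mu]_x f (1 - x)%R = \int[mu]_x f x.
Proof.
move=> mf f0; rewrite -[RHS](ge0_integral_addr 1)//.
rewrite -[RHS]ge0_integral_oppr//.
  by apply: eq_integral => x _; rewrite addrC.
by apply: (measurableT_comp mf); exact: measurable_funD.
Qed.

(** Both intervals contain [[0, a[]. The remaining piece [](a - T), 0[] is moved by [T] onto []a,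
    T[], which differs from [[a, T[] by one point. *)
Lemma ge0_integral_periodic (f : R -> \bar R) (T a : R) :
  measurable_fun setT f -> (forall x, 0 <= f x) ->
  (forall x, f (x + T)%R = f x) -> (0 <= a < T)%R ->
  \int[mu]_(x in `](a - T)%R, a[) f x = \int[mu]_(x in `[0%R, T[) f x.
Proof.
move=> mf f0 fT /andP[a0 aT].
have aT0 : (a - T < 0)%R by rewrite subr_lt0.
have aT' := ltW aT.
have mfA (A : set R) : measurable_fun A f by exact: measurable_funTS.
rewrite (@itv_bndbnd_setU _ _ _ (BLeft 0%R)) ?bnd_simp//.
rewrite [in RHS](@itv_bndbnd_setU _ _ _ (BLeft a)) ?bnd_simp//.
rewrite ge0_integral_setU//; last 2 first.
- exact: mfA.
- by apply/disj_setPS => x; rewrite /= !in_itv/= => -[]; lra.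
rewrite ge0_integral_setU//; last 2 first.
- exact: mfA.
- by apply/disj_setPS => x; rewrite /= !in_itv/= => -[]; lra.
rewrite [RHS]addeC; congr (_ + _).
rewrite [RHS](@integral_itv_bndoo _ a T f true true); last exact: mfA.
rewrite [RHS]integral_mkcond -(ge0_integral_addr T); last 2 first.
- by apply/(measurable_restrictT _ _).1.
- by move=> x; exact: erestrict_ge0.
rewrite integral_mkcond; apply: eq_integral => x _.
rewrite !patchE fT !mem_setE !in_itv/=.
by congr (if _ then _ else _); apply/idP/idP; lra.
Qed.

Section change_of_variables.
Variable F : R * R * R -> \bar R.
Hypotheses (mF : measurable_fun setT F) (F0 : forall w, 0 <= F w).

Let mFQ : measurable_fun (setT : set (plane R)) (fun z : plane R => F (Q z)).
Proof. by apply: (measurableT_comp mF); exact: measurable_Q. Qed.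

Let I u := \int[mu]_v F (Q (u, v)).

Let mI : measurable_fun setT I.
Proof.
exact: (@measurable_fun_fubini_tonelli_F _ _ (measurableTypeR R)
  (measurableTypeR R) R mu _ mFQ (fun=> F0 _)).
Qed.

(** Since [Q (- u, v) = Q (u, - v)], this is the reflection of the inner variable [v]. *)
Let I_even u : I (- u)%R = I u.
Proof.
rewrite /I -[RHS]ge0_integral_oppr//.
  by apply: eq_integral => v _; rewrite -[in RHS]QN -{1}(opprK v).
exact: (measurable_fun_pair2 u mFQ).
Qed.

(** The factor is the Jacobian [u] of [v = u s] when [u > 0], and 0 otherwise. The half-plane is
    thus encoded in a nonnegative function on the whole plane, to which Tonelli applies. *)
Let W (z : R * R) := F (Q (z.1, z.1 * z.2)%R) * (Num.max z.1 0%R)%:E.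

Let mW : measurable_fun (setT : set (plane R)) W.
Proof.
apply: emeasurable_funM.
  apply: (measurableT_comp mFQ); apply: measurable_fun_pair => //.
  exact: measurable_funM.
by apply/measurable_EFinP; apply: measurable_maxr.
Qed.

Let W0 z : 0 <= W z.
Proof. by rewrite mule_ge0// lee_fin le_max lexx orbT. Qed.

Let I_W : \int[mu]_(u in `]0%R, +oo[) I u = \int[mu]_u \int[mu]_s W (u, s).
Proof.
rewrite integral_mkcond; apply: eq_integral => u _; rewrite patchE.
rewrite mem_setE in_itv/= andbT; case: ltP => [u0|u0]; last first.
  rewrite /W/= (max_idPr u0).
  by under eq_integral do rewrite mule0; rewrite integral0.
have rangeu : range (fun s => u * s)%R = [set: R].
  apply/seteqP; split => // y _; exists (u^-1 * y)%R => //.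
  by rewrite mulVKf// gt_eqF.
have dmul x : is_derive x (1 : R)%R (fun s => u * s)%R (cst u x).
  by apply: is_derive_eq; rewrite /GRing.scale/= mulr1.
rewrite /I -[in LHS]rangeu (ge0_integration_by_substitution_setT dmul)//.
- by rewrite /W/= (max_idPl (ltW u0)).
- by move=> x; exact: cvg_cst.
- exact: (measurable_fun_pair2 u mFQ).
Qed.

Let J phi := \int[mu]_(t in `]0%R, +oo[) F (cone_param (t, phi)).

Let mFc : measurable_fun (setT : set (plane R))
  (fun z : plane R => F (cone_param z)).
Proof. by apply: (measurableT_comp mF); exact: measurable_cone_param. Qed.

Let J0 phi : 0 <= J phi.
Proof. by apply: integral_ge0 => t _; exact: F0. Qed.

Let mJ : measurable_fun setT J.
Proof.
(* This cutoff exhibits [J] as a partial integral of one function on the plane, hence as measurable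
   by Tonelli. *)
pose G := (fun z : plane R => F (cone_param z)) \_ (`]0%R, +oo[ `*` setT).
have mG : measurable_fun setT G.
  apply/(measurable_restrictT _ _).1; last exact: measurable_funTS.
  exact: measurableX.
have G0 z : 0 <= G z by apply: erestrict_ge0 => y _; exact: F0.
have -> : J = fubini_G mu G.
  apply/funext => phi; rewrite /J integral_mkcond; apply: eq_integral => t _.
  by rewrite /G !patchE in_setX in_setT andbT.
exact: (@measurable_fun_fubini_tonelli_G _ _ (measurableTypeR R)
  (measurableTypeR R) R mu _ mG G0).
Qed.

Let J_periodic phi : J (phi + 2 * pi)%R = J phi.
Proof.
apply: eq_integral => t _; congr F; rewrite /cone_param/=.
by rewrite mulr_natl cosD2pi sinD2pi.
Qed.

(** For fixed [s], [t = (1 + s ^ 2) u ^ 2] gives [dt = 2 (1 + s ^ 2) u du]; the weight [u] in [W] is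
    what this substitution absorbs. *)
Let W_J s :
  \int[mu]_u W (u, s) = (2 * (1 + s ^+ 2))^-1%:E * J (2 * atan s).
Proof.
have s0 : (0 < 1 + s ^+ 2)%R by rewrite ltr_pwDl// sqr_ge0.
pose phi u : R := ((1 + s ^+ 2) * u ^+ 2)%R.
pose dphi u : R := ((1 + s ^+ 2) * (2 * u))%R.
have dphiE u : is_derive u (1 : R)%R phi (dphi u).
  by apply: is_derive_eq; rewrite /dphi /GRing.scale/= mulr1 mulr_natl mulr2n.
have phi_gt0 : phi @` `]0%R, +oo[ = `]0%R, +oo[%classic.
  apply/seteqP; split => [_ [u + <-]|t]; rewrite /= !in_itv/= !andbT.
    by move=> u0; rewrite mulr_gt0// exprn_gt0.
  move=> t0; exists (Num.sqrt (t / (1 + s ^+ 2))).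
    by rewrite in_itv/= andbT sqrtr_gt0 divr_gt0.
  rewrite /phi sqr_sqrtr; last by rewrite ltW// divr_gt0.
  by rewrite mulrCA mulfV ?mulr1// gt_eqF.
have mphi : measurable_fun setT phi.
  by apply: measurable_funM => //; exact: measurable_funX.
have mdphi : measurable_fun setT dphi.
  by apply: measurable_funM => //; exact: measurable_funM.
have mFs : measurable_fun setT (fun t => F (cone_param (t, (2 * atan s)%R))).
  exact: (measurable_fun_pair1 _ mFc).
have dphi_ge0 u : (0 < u)%R -> (0 < dphi u)%R.
  by move=> u0; rewrite mulr_gt0// mulr_gt0.
rewrite /J -phi_gt0 (@ge0_integration_by_substitution_gt0 _ _ dphi)//; last first.
  move=> u _; apply: continuousM; first exact: cvg_cst.
  by apply: continuousM; [exact: cvg_cst|exact: cvg_id].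
rewrite -ge0_integralZl//; last 3 first.
- apply: measurable_funTS; apply: emeasurable_funM.
    exact: (measurableT_comp mFs).
  exact/measurable_EFinP.
- move=> u; rewrite /= in_itv/= andbT => u0.
  by rewrite mule_ge0// lee_fin ltW// dphi_ge0.
- by rewrite lee_fin invr_ge0 mulr_ge0// ltW.
rewrite [RHS]integral_mkcond; apply: eq_integral => u _.
rewrite patchE mem_setE in_itv/= andbT; case: ltP => [u0|u0]; last first.
  by rewrite /W/= (max_idPr u0) mule0.
rewrite /W/= (max_idPl (ltW u0)) cone_param_atan muleCA -EFinM.
by congr (_ * _%:E); rewrite /dphi; field; rewrite gt_eqF.
Qed.

Let I0 u : 0 <= I u.
Proof. by apply: integral_ge0 => v _; exact: F0. Qed.

Let range_2atan : range (fun s => 2 * atan s)%R = `](- pi)%R, pi[%classic :> set R.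
Proof.
apply/seteqP; split => [_ [s _ <-]|phi]; rewrite /= in_itv/=.
  by have := @atan_gtNpi2 R s; have := @atan_ltpi2 R s; lra.
move=> /andP[phi1 phi2]; exists (tan (phi / 2)) => //.
by rewrite tanK; [field|rewrite in_itv/=; lra].
Qed.

Let is_derive_2atan x :
  is_derive x (1 : R)%R (fun s => 2 * atan s)%R (2 / (1 + x ^+ 2))%R.
Proof. exact: is_derive_eq. Qed.

Let d2atan_gt0 (x : R) : (0 < 2 / (1 + x ^+ 2))%R.
Proof. by rewrite divr_gt0// ltr_pwDl// sqr_ge0. Qed.

Let continuous_d2atan : continuous (fun x : R => 2 / (1 + x ^+ 2))%R.
Proof.
move=> x; apply: cvgM; first exact: cvg_cst.
apply: cvgV; first by rewrite gt_eqF// ltr_pwDl// sqr_ge0.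
by apply: cvgD; [exact: cvg_cst|exact: exprn_continuous].
Qed.

Let mcJ : measurable_fun setT
  (fun s : R => (2 * (1 + s ^+ 2))^-1%:E * J (2 * atan s)).
Proof.
apply: emeasurable_funM.
  apply/measurable_EFinP; apply: continuous_measurable_fun => x.
  apply: cvgV; first by rewrite gt_eqF// mulr_gt0// ltr_pwDl// sqr_ge0.
  apply: cvgM; first exact: cvg_cst.
  by apply: cvgD; [exact: cvg_cst|exact: exprn_continuous].
apply: (measurableT_comp mJ); apply: measurable_funM => //.
by apply: continuous_measurable_fun; exact: continuous_atan.
Qed.

Let cJ0 s : 0 <= (2 * (1 + s ^+ 2))^-1%:E * J (2 * atan s).
Proof.
by rewrite mule_ge0// lee_fin invr_ge0 mulr_ge0// addr_ge0// sqr_ge0.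
Qed.

(** The constant: evenness in [u] gives 2, and the factor [1 / (2 (1 + s ^ 2))] from [W_J] is a
    quarter of the derivative [2 / (1 + s ^ 2)] of [2 * atan s]. *)
Lemma ge0_integral_Q :
  \int[lebesgue2 R]_z F (Q z) = 2^-1%:E *
    \int[lebesgue2 R]_(z in `[0%R, +oo[ `*` `[0%R, (2 * pi)%R[) F (cone_param z).
Proof.
rewrite [LHS](@fubini_tonelli1 _ _ (measurableTypeR R) (measurableTypeR R) R
  mu mu _ mFQ (fun=> F0 _)).
rewrite (ge0_integral_even mI I0 I_even) I_W (@fubini_tonelli _ _
  (measurableTypeR R) (measurableTypeR R) R mu mu _ mW W0).
under eq_integral do rewrite W_J.
transitivity (2^-1%:E * \int[mu]_(phi in `](- pi)%R, pi[) J phi).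
  rewrite -range_2atan (ge0_integration_by_substitution_setT is_derive_2atan
    continuous_d2atan d2atan_gt0 mJ J0).
  have -> : \int[mu]_s (J (2 * atan s) * (2 / (1 + s ^+ 2))%:E) =
      4%:E * \int[mu]_s ((2 * (1 + s ^+ 2))^-1%:E * J (2 * atan s)).
    rewrite -ge0_integralZl; [|by []|exact: mcJ|by move=> s _; exact: cJ0|by []].
    apply: eq_integral => s _; rewrite muleA -EFinM muleC; congr (_%:E * _).
    by field; rewrite gt_eqF// ltr_pwDl// sqr_ge0.
  by rewrite muleA -EFinM; congr (_%:E * _); field.
(* The angles [2 * atan s] fill [](- pi), pi[], whereas the cone is parametrized over [[0, 2 * pi[];
   periodicity of [J] moves one onto the other. *)
rewrite (_ : - pi = pi - 2 * pi)%R; last by ring.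
rewrite (ge0_integral_periodic mJ J0 J_periodic); last first.
  by rewrite pi_ge0/=; have := pi_gt0 R; lra.
apply: (congr1 (mule 2^-1%:E)).
pose G := (fun z : plane R => F (cone_param z)) \_
  (`[0%R, +oo[ `*` `[0%R, (2 * pi)%R[).
have mG : measurable_fun setT G.
  apply/(measurable_restrictT _ _).1; last exact: measurable_funTS.
  exact: measurableX.
have G0 z : 0 <= G z by apply: erestrict_ge0 => y _; exact: F0.
rewrite [RHS]integral_mkcond.
rewrite [RHS](@fubini_tonelli2 _ _ (measurableTypeR R) (measurableTypeR R) R
  mu mu _ mG G0).
rewrite integral_mkcond; apply: eq_integral => phi _.
rewrite patchE /fubini_G /G; case: ifPn => phi0; last first.
  apply/esym/integral0_eq => t _.
  by rewrite patchE in_setX (negbTE phi0) andbF.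
(* [J] integrates over [t > 0], the right side over [t >= 0]; the apex is a null set. *)
rewrite /J integral_itv_obnd_cbnd; last first.
  by apply: measurable_funTS; exact: (measurable_fun_pair1 _ mFc).
rewrite [LHS]integral_mkcond; apply: eq_integral => t _.
by rewrite !patchE in_setX phi0 andbT.
Qed.

End change_of_variables.

End Polar.

(** * Equality of [nuV] with the image of [muB], and total mass *)

Section MeasureTransport.
Context (R : realType) (gamma : R) (hgamma : -1 < gamma).
Local Notation mu := (@lebesgue_measure R).
Local Open Scope ereal_scope.

(** The density of [muB] as a function of [t]. It is cut off only above 1, because [t >= 0] is
    imposed by the domain in [ge0_integral_Q]; there [nu_density] is half of it, the half being the
    constant of that lemma. *)
Let radial_density : R -> R :=
  (fun t => ((gamma + 1) / pi * (1 - t) `^ gamma)%R) \_ `]-oo, 1%R].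

Let radial_density_ge0 t : (0 <= radial_density t)%R.
Proof.
apply: restrict_ge0 => {}t _; rewrite mulr_ge0 ?powR_ge0// divr_ge0 ?pi_ge0//.
by rewrite -lerBlDr sub0r ltW.
Qed.

Let measurable_radial_density : measurable_fun setT radial_density.
Proof.
apply/(measurable_restrictT _ _).1 => //; apply: measurable_funTS.
apply: measurable_funM => //; apply: (measurableT_comp (measurable_powR gamma)).
exact: measurable_funB.
Qed.

Let mu_densityE z : mu_density gamma z = radial_density (Q z).2.
Proof.
rewrite /mu_density /radial_density !patchE.
have -> : (z \in @disc R) = ((Q z).2 \in `]-oo, 1%R]%classic).
  by apply/idP/idP; rewrite !inE.
by rewrite /= opprD addrA.
Qed.

Let nu_densityE z : (`[0%R, +oo[ `*` `[0%R, (2 * pi)%R[)%classic z ->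
  nu_density gamma z = (2^-1 * radial_density z.1)%R.
Proof.
move=> []; rewrite /= !in_itv/= andbT => z1 z2.
rewrite /nu_density /radial_density !patchE in_setX !mem_setE.
rewrite !in_itv/= z1 z2 andbT/=; case: ifPn => _; last by rewrite mulr0.
by rewrite invfM !mulrA [((gamma + 1) * _)%R]mulrC.
Qed.

Lemma nuV_pushforward (A : set (R * R * R)) : measurable A ->
  nuV hgamma A = pushforward (muB hgamma) (@Q R) A.
Proof.
move=> mA; pose F (w : R * R * R) := (radial_density w.2 * \1_A w)%:E.
have mF : measurable_fun setT F.
  apply/measurable_EFinP; apply: measurable_funM; last exact: measurable_indic.
  exact: (measurableT_comp measurable_radial_density).
have F0 w : 0 <= F w by rewrite lee_fin mulr_ge0.
transitivity (\int[lebesgue2 R]_z F (Q z)); last first.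
  rewrite /pushforward /muB /density_measure [RHS]integral_mkcond.
  apply: eq_integral => z _; rewrite /F patchE -mu_densityE indicE.
  rewrite (_ : (z \in _) = (Q z \in A)); last by apply/idP/idP; rewrite !inE.
  by case: ifPn => _; rewrite ?mulr1 ?mulr0.
rewrite ge0_integral_Q// -ge0_integralZl//; last 2 first.
- exact: measurableX.
- apply: measurable_funTS; apply: (measurableT_comp mF).
  exact: measurable_cone_param.
rewrite /nuV /pushforward /density_measure [LHS]integral_mkcond [RHS]integral_mkcond.
apply: eq_integral => z _; rewrite !patchE /F indicE.
rewrite (_ : (z \in _ @^-1` _) = (cone_param z \in A)); last first.
  by apply/idP/idP; rewrite !inE.
have [zS|zS] := boolP (z \in `[0%R, +oo[ `*` `[0%R, (2 * pi)%R[).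
  rewrite nu_densityE; last exact: set_mem.
  by case: ifPn => _; rewrite ?mulr1 ?mulr0 ?mule0 ?EFinM.
case: ifPn => // _; congr _%:E; rewrite /nu_density patchE ifF//.
apply: contraNF zS; rewrite !in_setX => /andP[+ ->]; rewrite andbT.
by rewrite !mem_setE !in_itv/= andbT => /andP[].
Qed.

(** Substitute [y = t ^ (gamma + 1)]. For [gamma < 0] the integrand is unbounded at 0, so the
    substitution is made on the open half-line and the indicator [h] cuts out the unit interval. *)
Let integral_powR : \int[mu]_(t in `]0%R, 1%R[) ((gamma + 1) * t `^ gamma)%:E = 1.
Proof.
pose phi t : R := (t `^ (gamma + 1))%R.
pose dphi t : R := ((gamma + 1) * t `^ gamma)%R.
have g1 : (0 < gamma + 1)%R by rewrite -ltrBlDr sub0r.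
have imphi : phi @` `]0%R, +oo[ = `]0%R, +oo[%classic.
  apply/seteqP; split => [_ [t + <-]|y]; rewrite /= !in_itv/= !andbT.
    exact: powR_gt0.
  move=> y0; exists (y `^ (gamma + 1)^-1)%R.
    by rewrite in_itv/= andbT powR_gt0.
  by rewrite /phi -powRrM mulVf ?powRr1 ?gt_eqF// ltW.
have dphiE (t : R) : (0 < t)%R -> is_derive t (1 : R)%R phi (dphi t).
  by move=> t0; have := is_derive1_powR (gamma + 1) t0; rewrite addrK.
pose h t : \bar R := (\1_(`]0%R, 1%R[%classic : set R) t)%:E.
have mh : measurable_fun setT h by exact/measurable_EFinP/measurable_indic.
have mphi : measurable_fun setT phi by exact: measurable_powR.
have mdphi : measurable_fun setT dphi.
  by apply: measurable_funM => //; exact: measurable_powR.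
have cdphi (t : R) : (0 < t)%R -> {for t, continuous dphi}.
  move=> t0; apply: continuousM; first exact: cvg_cst.
  apply: differentiable_continuous; apply/derivable1_diffP.
  by apply: derivable_powR; rewrite in_itv/= andbT.
have dphi_gt0 (t : R) : (0 < t)%R -> (0 < dphi t)%R.
  by move=> t0; rewrite mulr_gt0// powR_gt0.
have h0 (t : R) : 0 <= h t by rewrite lee_fin.
transitivity (\int[mu]_(y in phi @` `]0%R, +oo[) h y); last first.
  rewrite imphi integral_indic// setIidl.
    by rewrite [LHS]lebesgue_measure_itv/= lte_fin ltr01 oppr0 adde0.
  by move=> t; rewrite /= !in_itv/= andbT => /andP[].
rewrite (ge0_integration_by_substitution_gt0 mphi mdphi dphiE cdphi dphi_gt0 mh h0).
rewrite [LHS]integral_mkcond [RHS]integral_mkcond; apply: eq_integral => t _.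
have pw1 : (1 `^ (gamma + 1) = 1 :> R)%R by rewrite powR1.
rewrite !patchE /h indicE !mem_setE !in_itv/= andbT.
case: ltP => //= t0; rewrite powR_gt0//=.
have [t1|t1] := ltP t 1%R.
  rewrite (_ : (phi t < 1)%R) ?mul1e//.
  by rewrite -pw1 gt0_ltr_powR// nnegrE ltW.
rewrite ltNge (_ : (1 <= phi t)%R) ?mul0e//.
by rewrite -pw1 ge0_ler_powR ?nnegrE ?(ltW t0) ?(ltW g1).
Qed.

(** The density is a product of [(gamma + 1) (1 - t) ^ gamma] in [t] and the uniform density in
    [phi], each of integral 1. The mass of the disc is then deduced by transport. *)
Lemma nuV_setT : nuV hgamma setT = 1.
Proof.
pose g := (fun t => ((gamma + 1) * t `^ gamma)%:E) \_ `[0%R, 1%R].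
have mg : measurable_fun setT g.
  apply/(measurable_restrictT _ _).1 => //; apply: measurable_funTS.
  apply/measurable_EFinP; apply: measurable_funM => //; exact: measurable_powR.
have g0 t : 0 <= g t.
  apply: erestrict_ge0 => {}t _; rewrite lee_fin mulr_ge0 ?powR_ge0//.
  by rewrite -lerBlDr sub0r ltW.
have pi2 : (0 < 2 * pi :> R)%R by rewrite mulr_gt0// pi_gt0.
rewrite /nuV /pushforward /density_measure preimage_setT.
have mnu := measurable_nu_density gamma.
rewrite (@fubini_tonelli1 _ _ (measurableTypeR R) (measurableTypeR R) R mu mu
  (EFin \o nu_density gamma)); last 2 first.
- exact/measurable_EFinP.
- by move=> z; rewrite lee_fin nu_density_ge0.
transitivity (\int[mu]_t g (1 - t)%R); last first.
  rewrite ge0_integral_onem// /g -integral_mkcond.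
  rewrite integral_itv_bndoo//.
  apply/measurable_EFinP; apply: measurable_funTS.
  by apply: measurable_funM => //; exact: measurable_powR.
apply: eq_integral => t _.
transitivity (\int[mu]_phi (g (1 - t)%R *
    ((2 * pi)^-1 * \1_(`[0%R, (2 * pi)%R[%classic : set R) phi)%:E)).
  apply: eq_integral => phi _; rewrite /nu_density /g /= !patchE in_setX indicE.
  rewrite !mem_setE !in_itv/= subr_ge0 gerBl [(t <= 1)%R && _]andbC.
  case: (0 <= phi < 2 * pi)%R; last by rewrite andbF mulr0 mule0.
  rewrite andbT mulr1; case: ifP => _; last by rewrite mul0e.
  by rewrite -EFinM mulrAC.
rewrite ge0_integralZl//; last 2 first.
- apply/measurable_EFinP; apply: measurable_funM => //; exact: measurable_indic.
- by move=> phi _; rewrite lee_fin mulr_ge0// invr_ge0 ltW.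
under eq_integral do rewrite EFinM.
rewrite ge0_integralZl//; last 2 first.
- exact/measurable_EFinP/measurable_indic.
- by rewrite lee_fin invr_ge0 ltW.
rewrite integral_indic// setIT [X in _ * (_ * X)]lebesgue_measure_itv/= lte_fin pi2.
by rewrite oppr0 adde0 -EFinM mulVf ?mule1// gt_eqF.
Qed.

End MeasureTransport.

(** * Square integrability and inner products *)

Section RealPart.
Context (R : realType) (K : comNzRingType) (iota : {rmorphism R -> K}) (L : K -> R).
Hypotheses (L0 : L 0 = 0) (LD : {morph L : x y / x + y}).
Hypothesis LZ : forall c x, L (c * iota x) = L c * x.

(** [L] stands for the real or the imaginary part. The points have real coordinates, so every
    monomial takes real values and [L] acts on the coefficients alone. *)
Lemma realpart_polyrestr T n (coord : T -> 'I_n -> R) (A : set T) p :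
  exists q, L \o polyrestr iota coord A p = polyrestr idfun coord A q.
Proof.
exists (\sum_(m <- msupp p) L (mcoeff m p) *: mpolyX R m).
apply/funext => z; rewrite /polyrestr /= /patch; case: ifP => // _.
rewrite meval_sum mevalE (big_morph L LD L0); apply: eq_bigr => m _.
rewrite mevalZ mevalX -LZ rmorph_prod.
by congr (L (_ * _)); apply: eq_bigr => i _; rewrite rmorphXn.
Qed.

End RealPart.

Lemma polyrestr_bounded (T : Type) (R : realType) (n : nat)
    (coord : T -> 'I_n -> R) (A : set T) (q : mpoly n R) :
  (forall z i, A z -> `|coord z i| <= 1) ->
  exists M, forall z, `|polyrestr idfun coord A q z| <= M.
Proof.
(* All coordinates are at most 1 in absolute value on [A], hence so are all monomials. *)
move=> coord1; exists (\sum_(m <- msupp q) `|mcoeff m q|) => z.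
rewrite /polyrestr /patch; case: ifPn => [/set_mem Az|_]; last first.
  by rewrite normr0 sumr_ge0.
rewrite mevalE (le_trans (ler_norm_sum _ _ _))// ler_sum// => m _.
rewrite normrM ler_piMr// normr_prod prodr_ile1// => i _.
by rewrite normr_ge0 normrX exprn_ile1//= coord1.
Qed.

Section RealPolynomials.
Context d (T : measurableType d) (R : realType) (n : nat).
Variables (coord : T -> 'I_n -> R) (A : set T) (q : mpoly n R).
Hypothesis mA : measurable A.
Hypothesis mcoord : forall i, measurable_fun setT (coord ^~ i).

Lemma measurable_polyrestr : measurable_fun setT (polyrestr idfun coord A q).
Proof.
rewrite /polyrestr.
apply/(@measurable_restrictT _ _ _ R A (fun z => meval (idfun \o coord z) q)) => //.
apply: measurable_funTS; under eq_fun do rewrite mevalE.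
apply: measurable_sum => m; apply: measurable_funM => //.
by apply: measurable_prod => i _; apply: measurable_funX; exact: mcoord.
Qed.

End RealPolynomials.

Lemma L2_bounded d (T : measurableType d) (R : realType)
    (mu : {measure set T -> \bar R}) (f : T -> R) (M : R) :
  (mu setT < +oo)%E -> measurable_fun setT f -> (forall x, `|f x| <= M) ->
  L2 mu f.
Proof.
move=> muT mf fM; rewrite /L2 /= inE/=; apply/andP; split; rewrite inE//=.
rewrite /finite_norm unlock poweR_lty//.
apply: (@le_lt_trans _ _ (\int[mu]_x (cst (M `^ 2)%:E x))%E).
  apply: ge0_le_integral => //.
  - by move=> x _; rewrite lee_fin powR_ge0.
  - apply/measurable_EFinP.
    by apply: (measurableT_comp (measurable_powR 2)); exact: measurableT_comp.
  - move=> x _; rewrite lee_fin ge0_ler_powR ?nnegrE//.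
    exact: le_trans (fM x).
by rewrite integral_cst// lte_mul_pinfty// ?lee_fin ?powR_ge0.
Qed.

(** * Integrals along [Q] and square integrability of polynomials *)

Section Unitary.
Context (R : realType) (gamma : R) (hgamma : -1 < gamma).

Lemma measurable_coord2 i :
  measurable_fun (setT : set (plane R)) ((@coord2 R)^~ i).
Proof.
rewrite (_ : _ ^~ i = if val i == 0%N then fst else snd); last first.
  by apply/funext => z; rewrite /coord2 (tnth_nth 0); case: i => [[|[|//]] ?].
by case: ifP => _; [exact: measurable_fst|exact: measurable_snd].
Qed.

Lemma measurable_coord3 i :
  measurable_fun (setT : set (R * R * R)) ((@coord3 R)^~ i).
Proof.
rewrite (_ : _ ^~ i = nth (fun _ : R * R * R => 0)
    [:: fst \o fst; snd \o fst; snd] i); last first.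
  by apply/funext => z; rewrite /coord3 (tnth_nth 0); case: i => [[|[|[|//]]] ?].
case: i => [[|[|[|//]]] ?] /=; last exact: measurable_snd.
- by apply: measurableT_comp; exact: measurable_fst.
- by apply: measurableT_comp; [exact: measurable_snd|exact: measurable_fst].
Qed.

(** Equality of measures gives the claim for nonnegative functions; it is applied to the positive
    and negative parts of [h], which commute with composition by [Q]. *)
Lemma integral_pullback (h : R * R * R -> R) : measurable_fun setT h ->
  \int[muB hgamma]_z h (Q z) = \int[nuV hgamma]_w h w.
Proof.
move=> mh; congr fine; have mQ := @measurable_Q R.
have ge0_pullback (k : R * R * R -> \bar R) : measurable_fun setT k ->
    (forall w, 0 <= k w)%E ->
    (\int[muB hgamma]_z k (Q z) = \int[nuV hgamma]_w k w)%E.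
  move=> mk k0.
  transitivity (\int[pushforward (muB hgamma) (@Q R : plane R -> _)]_w k w)%E.
    rewrite ge0_integral_pushforward//.
  by apply: eq_measure_integral => B mB _; exact/esym/nuV_pushforward.
have mEh : measurable_fun setT (EFin \o h) by exact/measurable_EFinP.
rewrite [LHS]integralE [RHS]integralE -[in RHS]ge0_pullback; last 2 first.
- exact: measurable_funepos.
- by [].
rewrite -[in RHS]ge0_pullback; last 2 first.
- exact: measurable_funeneg.
- by [].
rewrite (_ : (fun z => (h (Q z))%:E) = (EFin \o h) \o @Q R)//.
by rewrite funepos_comp funeneg_comp.
Qed.

Lemma muB_setT : muB hgamma setT = 1%E.
Proof.
by rewrite -(nuV_setT hgamma) nuV_pushforward// /pushforward preimage_setT.
Qed.

Lemma measurable_disc : measurable (@disc R : set (plane R)).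
Proof.
have -> : @disc R = (fun z : plane R => z.1 ^+ 2 + z.2 ^+ 2) @^-1` `]-oo, 1].
  by apply/seteqP; split => z; rewrite /disc/= in_itv.
rewrite -[X in measurable X]setTI.
by apply: (measurable_funD (measurable_funX _ _) (measurable_funX _ _)).
Qed.

Lemma measurable_cone : measurable (@cone R : set (R * R * R)).
Proof.
have mx : measurable_fun setT (fun w : R * R * R => w.1.1).
  by apply: measurableT_comp; exact: measurable_fst.
have my : measurable_fun setT (fun w : R * R * R => w.1.2).
  by apply: measurableT_comp; [exact: measurable_snd|exact: measurable_fst].
have -> : @cone R =
    (fun w => w.1.1 ^+ 2 + w.1.2 ^+ 2 - w.2 ^+ 2) @^-1` [set 0] `&`
    (fun w => w.2) @^-1` `[0, 1].
  apply/seteqP; split => w; rewrite /cone/= in_itv/=.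
    by move=> [-> ->]; rewrite subrr.
  by move=> [/eqP]; rewrite subr_eq0 => /eqP.
apply: measurableI; rewrite -[X in measurable X]setTI.
  apply: measurable_funB => //; last exact: measurable_funX.
  by apply: measurable_funD; exact: measurable_funX.
exact: measurable_snd.
Qed.

Lemma disc_coord2_le1 (z : R * R) i : disc z -> `|coord2 z i| <= 1.
Proof.
rewrite /disc/= => z1; have [u0 v0] := (sqr_ge0 z.1, sqr_ge0 z.2).
rewrite -(@expr_le1 _ 2)// real_normK ?num_real// /coord2 (tnth_nth 0).
by case: i => [[|[|//]] ?] /=; lra.
Qed.

Lemma cone_coord3_le1 (w : R * R * R) i : cone w -> `|coord3 w i| <= 1.
Proof.
move=> [e /andP[t0 t1]].
have t2 : w.2 ^+ 2 <= 1 by rewrite exprn_ile1.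
have [x0 y0] := (sqr_ge0 w.1.1, sqr_ge0 w.1.2).
rewrite -(@expr_le1 _ 2)// real_normK ?num_real// /coord3 (tnth_nth 0).
by case: i => [[|[|[|//]]] ?] /=; lra.
Qed.

Lemma measurable_polyrestr_cone q :
  measurable_fun setT (polyrestr idfun (@coord3 R) cone q).
Proof.
by apply: measurable_polyrestr; [exact: measurable_cone|exact: measurable_coord3].
Qed.

Lemma L2_polyrestr_cone q :
  L2 (nuV hgamma) (polyrestr idfun (@coord3 R) cone q).
Proof.
have [|M fM] := polyrestr_bounded (coord := @coord3 R) (A := cone) q.
  by move=> w i; exact: cone_coord3_le1.
apply: L2_bounded fM; last exact: measurable_polyrestr_cone.
by rewrite [ltLHS]nuV_setT ltry.
Qed.

Lemma L2_polyrestr_disc q :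
  L2 (muB hgamma) (polyrestr idfun (@coord2 R) disc q).
Proof.
have [|M fM] := polyrestr_bounded (coord := @coord2 R) (A := disc) q.
  by move=> w i; exact: disc_coord2_le1.
apply: (@L2_bounded _ _ R (muB hgamma) _ M) => //.
  by rewrite [ltLHS]muB_setT ltry.
by apply: measurable_polyrestr; [exact: measurable_disc|exact: measurable_coord2].
Qed.

End Unitary.

Section ComplexParts.
Variables (R : realType) (T : Type) (n : nat) (coord : T -> 'I_n -> R) (A : set T).

Lemma Re_polyrestr p : exists q,
  (fun z => complex.Re (polyrestr (real_complex R) coord A p z)) =
  polyrestr idfun coord A q.
Proof.
apply: (@realpart_polyrestr R R[i] (real_complex R) (@complex.Re R)) => //.
- by move=> [a b] [c d].
- by move=> [a b] x /=; rewrite mulr0 subr0.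
Qed.

Lemma Im_polyrestr p : exists q,
  (fun z => complex.Im (polyrestr (real_complex R) coord A p z)) =
  polyrestr idfun coord A q.
Proof.
apply: (@realpart_polyrestr R R[i] (real_complex R) (@complex.Im R)) => //.
- by move=> [a b] [c d].
- by move=> [a b] x /=; rewrite mulr0 add0r.
Qed.

End ComplexParts.

(* The first part is about real-valued polynomials, the second one about
   complex-valued polynomials. *)
Theorem theorem3p3 (R : realType) (gamma : R) (hgamma : -1 < gamma) (m : nat) :
  [/\ linear (@pullback R R^o : (R * R * R -> R^o) -> (R * R -> R^o)),
      set_bij (PiV idfun m) (PiB_even idfun (2 * m)) (@pullback R R),
      PiV idfun m `<=` L2 (nuV hgamma),
      PiB_even idfun (2 * m) `<=` L2 (muB hgamma)
    & forall f g : R * R * R -> R, PiV idfun m f -> PiV idfun m g ->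
        dot (muB hgamma) (pullback f) (pullback g) = dot (nuV hgamma) f g]
  /\
  [/\ linear (@pullback R R[i]^o : (R * R * R -> R[i]^o) -> (R * R -> R[i]^o)),
      set_bij (PiV (real_complex R) m) (PiB_even (real_complex R) (2 * m))
        (@pullback R R[i]),
      PiV (real_complex R) m `<=` L2C (nuV hgamma),
      PiB_even (real_complex R) (2 * m) `<=` L2C (muB hgamma)
    & forall f g : R * R * R -> R[i],
        PiV (real_complex R) m f -> PiV (real_complex R) m g ->
        dotC (muB hgamma) (pullback f) (pullback g) = dotC (nuV hgamma) f g].

Proof.
split; split.
- by move=> a f g; apply/funext.
- exact: (@pullback_bij R R idfun m).
- by move=> _ [p _ <-]; exact: L2_polyrestr_cone.
- by move=> _ [[p _ <-] _]; exact: L2_polyrestr_disc.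
- move=> _ _ [p _ <-] [q _ <-]; rewrite /dot -integral_pullback//.
  by apply: measurable_funM; exact: measurable_polyrestr_cone.
- by move=> a f g; apply/funext.
- exact: (@pullback_bij R R[i] (real_complex R) m).
- move=> _ [p _ <-]; split.
    by have [q ->] := Re_polyrestr (@coord3 R) cone p; exact: L2_polyrestr_cone.
  by have [q ->] := Im_polyrestr (@coord3 R) cone p; exact: L2_polyrestr_cone.
- move=> _ [[p _ <-] _]; split.
    by have [q ->] := Re_polyrestr (@coord2 R) disc p; exact: L2_polyrestr_disc.
  by have [q ->] := Im_polyrestr (@coord2 R) disc p; exact: L2_polyrestr_disc.
- move=> _ _ [p _ <-] [q _ <-].
  set f := polyrestr _ _ _ p; set g := polyrestr _ _ _ q.
  have mRe (r : mpoly 3 R[i]) : measurable_fun setT (fun w =>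
      complex.Re (polyrestr (real_complex R) (@coord3 R) cone r w)).
    have [s ->] := Re_polyrestr (@coord3 R) cone r.
    exact: measurable_polyrestr_cone.
  have mIm (r : mpoly 3 R[i]) : measurable_fun setT (fun w =>
      complex.Im (polyrestr (real_complex R) (@coord3 R) cone r w)).
    have [s ->] := Im_polyrestr (@coord3 R) cone r.
    exact: measurable_polyrestr_cone.
  rewrite /dotC -!integral_pullback//.
  (* Measurability is read off after expanding the product into real and imaginary parts of [f] and
     [g], which are restrictions of real polynomials. *)
  + rewrite (_ : (fun w => complex.Im _) = (fun w =>
        complex.Im (f w) * complex.Re (g w) -
        complex.Re (f w) * complex.Im (g w))).
      by apply: measurable_funB; apply: measurable_funM;
        first [exact: mRe|exact: mIm].
    by apply/funext => w; case: (f w) => a b; case: (g w) => c e /=; ring.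
  + rewrite (_ : (fun w => complex.Re _) = (fun w =>
        complex.Re (f w) * complex.Re (g w) +
        complex.Im (f w) * complex.Im (g w))).
      by apply: measurable_funD; apply: measurable_funM;
        first [exact: mRe|exact: mIm].
    by apply/funext => w; case: (f w) => a b; case: (g w) => c e /=; ring.
Qed.
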